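(* Let $\epsilon_E>0$ and $\alpha=2e^{-2N_s\epsilon_E^2}$. Suppose that for all $x\in\mathcal{D}_i$, $$|\hat\Phi^E_{p_i^{\top}\overline{G}\overline{\mathbf{w}}}(x)-\hat\Phi_{p_i^{\top}\overline{G}\overline{\mathbf{w}}}(x)|\le\epsilon_D .$$ Then, with probability at least $1-\alpha$, $$|\hat\Phi_{p_i^{\top}\overline{G}\overline{\mathbf{w}}}(x)-\Phi_{p_i^{\top}\overline{G}\overline{\mathbf{w}}}(x)|\le\epsilon_E+\epsilon_D\qquad\text{for all }x\in\mathcal{D}_i .$$
   Context: Let $\overline{\mathbf{w}}\in\mathbb{R}^{pN}$ be a random vector, $\overline{G}\in\mathbb{R}^{n(N+1)\times pN}$ a matrix and $p_i\in\mathbb{R}^{n(N+1)}$ a vector, so that $p_i^\top\overline{G}\overline{\mathbf{w}}$ is a real random variable. Let $\Phi_{p_i^\top\overline{G}\overline{\mathbf{w}}}$ be its cumulative distribution function. Let $\overline{\mathbf{w}}_1,\dots,\overline{\mathbf{w}}_{N_s}$ be $N_s$ independent samples of $\overline{\mathbf{w}}$. The empirical cumulative distribution function is $\hat\Phi^E_{p_i^\top\overline{G}\overline{\mathbf{w}}}(x)=\frac1{N_s}\#\{j: p_i^\top\overline{G}\overline{\mathbf{w}}_j\le x\}$. The smoothed approximation $\hat\Phi_{p_i^\top\overline{G}\overline{\mathbf{w}}}$ is obtained from the empirical characteristic function $$\hat\varphi(s)=\frac1{N_s}\sum_{j=1}^{N_s}\exp(is\,p_i^\top\overline{G}\overline{\mathbf{w}}_j)\exp\left(-\tfrac12(p_i^\top\overline{G})\overline{\Sigma}(p_i^\top\overline{G})^\top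 s^2\right),\qquad s\in\mathbb{R},$$ where $\overline{\Sigma}\in\mathbb{R}^{pN\times pN}$ is a symmetric positive semidefinite smoothing matrix, by the inversion formula $$\hat\Phi_{p_i^\top\overline{G}\overline{\mathbf{w}}}(x)=\frac12-\frac1\pi\int_0^\infty\mathrm{Im}\left(\frac{e^{-isx}\hat\varphi(s)}{s}\right)ds .$$ $\mathcal{D}_i=[x_i^{lb},\infty)$ for some $x_i^{lb}\in\mathbb{R}$, and $\epsilon_D\ge0$ is a constant. Probability is with respect to the draw of the samples. The hypothesis on $\epsilon_D$ is a standing assumption, taken to hold for the drawn samples. *)

(* Defs.v *)
From HB Require Import structures.
From mathcomp Require Import all_boot all_order all_algebra.
From mathcomp Require Import complex.
From mathcomp Require Import all_classical all_reals all_analysis.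
From mathcomp Require Import measurable_realfun.

Set Implicit Arguments.
Unset Strict Implicit.
Unset Printing Implicit Defensive.

Import Order.TTheory GRing.Theory Num.Theory.
Import numFieldNormedType.Exports.

Local Open Scope classical_set_scope.
Local Open Scope complex_scope.
Local Open Scope ring_scope.

(* R^m with its Borel sigma-algebra; the carrier is convertible to 'cV[R]_m. *)
Definition borel_cV (R : realType) (m : nat) :=
  g_sigma_algebraType (@open 'cV[R]_m).

Definition lin_form (R : realType) (m : nat) (a : 'rV[R]_m)
    (v : borel_cV R m) : R :=
  (a *m (v : 'cV[R]_m)) 0 0.

Lemma lin_form_continuous (R : realType) (m : nat) (a : 'rV[R]_m) :
  continuous (@lin_form R m a : 'cV[R]_m -> R).
Proof.
have -> : (@lin_form R m a : 'cV[R]_m -> R) =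
    (fun v : 'cV[R]_m => \sum_(k < m) a 0 k * v k 0).
  by apply/funext => v; rewrite /lin_form mxE.
apply: continuous_big => [|k _ v]; first exact: add_continuous.
by apply: (@cvgMl_tmp _ _ (nbhs v)); exact: coord_continuous.
Qed.

Lemma measurable_lin_form (R : realType) (m : nat) (a : 'rV[R]_m) :
  measurable_fun [set: borel_cV R m] (lin_form a).
Proof.
apply: (measurability _ (RGenOpens.measurableE R)) => _ [_ [x [y ->]] <-].
rewrite setTI; apply: sub_sigma_algebra.
by have /continuousP := @lin_form_continuous R m a; apply; exact: interval_open.
Qed.

HB.instance Definition _ (R : realType) (m : nat) (a : 'rV[R]_m) :=
  isMeasurableFun.Build _ _ (borel_cV R m) R (lin_form a)
    (@measurable_lin_form R m a).

Definition psd (R : realType) (m : nat) (S : 'M[R]_m) : Prop :=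
  S^T = S /\ forall u : 'rV[R]_m, 0 <= (u *m S *m u^T) 0 0.

(* Joint independence; taking some of the B j to be the whole space gives the
   product rule for every subfamily. *)
Definition independent (d d' : measure_display) (T : measurableType d)
    (T' : measurableType d') (R : realType) (P : probability T R) (k : nat)
    (X : 'I_k -> {RV P >-> T'}) : Prop :=
  forall B : 'I_k -> set T', (forall j, measurable (B j)) ->
    P [set t | forall j, B j (X j t)] = (\prod_(j < k) P (X j @^-1` B j))%E.

Definition same_distribution (d1 d2 d' : measure_display)
    (T1 : measurableType d1) (T2 : measurableType d2) (T' : measurableType d')
    (R : realType) (P1 : probability T1 R) (P2 : probability T2 R)
    (X1 : {RV P1 >-> T'}) (X2 : {RV P2 >-> T'}) : Prop :=
  forall B : set T', measurable B ->
    distribution P1 X1 B = distribution P2 X2 B.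

(* Inner-probability form: E is not required to be measurable. *)
Definition with_probability_ge (d : measure_display) (T : measurableType d)
    (R : realType) (P : probability T R) (q : R) (E : set T) : Prop :=
  exists A : set T, [/\ measurable A, (q%:E <= P A)%E & A `<=` E].

Definition empirical_cdf (R : realType) (k : nat) (y : 'I_k -> R) (x : R) : R :=
  k%:R^-1 * #|[set j : 'I_k | y j <= x]%SET|%:R.

(* e^{it} *)
Definition expi (R : realType) (t : R) : R[i] := cos t +i* sin t.

Definition smoothed_ecf (R : realType) (k : nat) (y : 'I_k -> R) (v : R)
    (s : R) : R[i] :=
  k%:R^-1 *
    \sum_(j < k) expi (s * y j) * (expR (- (2^-1 * v * s ^+ 2)))%:C.

(* The inversion integral is improper at infinity: for v = 0 the integrand is
   in general not Lebesgue integrable on ]0, +oo[. It is bounded near 0. *)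
Definition smoothed_cdf (R : realType) (k : nat) (y : 'I_k -> R) (v : R)
    (x : R) : R :=
  2^-1 - pi^-1 *
    lim (\int[lebesgue_measure]_(s in `]0, S])
           complex.Im (expi (- (s * x)) * smoothed_ecf y v s / s%:C)
         @[S --> +oo]).

(* Main.v *)
Require Import Defs.
From mathcomp Require Import all_boot all_order all_algebra.
From mathcomp Require Import ring lra.
From mathcomp Require Import all_classical all_reals all_analysis.

Set Implicit Arguments.
Unset Strict Implicit.
Unset Printing Implicit Defensive.

Import Order.TTheory GRing.Theory Num.Theory.
Import numFieldNormedType.Exports.

Local Open Scope classical_set_scope.
Local Open Scope ring_scope.

(** By the triangle inequality it is enough that the empirical distribution
    function of the n samples is within e of the distribution function F,
    uniformly, with probability at least 1 - 2 * expR (- (2 * n * e ^+ 2)): this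
    is the Dvoretzky-Kiefer-Wolfowitz inequality with Massart's constant
    (dkw_massart). The smoothing enters only through the assumed bound epsD.

    Each sign of the deviation is bounded by expR (- (2 * n * e ^+ 2)), for all
    e > 0 and all F, continuous or not, through one exponential tilt. Write S(x)
    for the number of samples at most x. For z > 0 the product
    (1 + z / F(x)) ^+ S(x) is a martingale in decreasing x, of expectation
    (1 + z) ^+ n. At the first x, from the top, with S(x) >= n * (F(x) + e), it
    is at least expR (n * (F(x) + e) * ln (1 + z / F(x))). The lemma
    exponential_tilt provides a z, depending on e only, for which this is at
    least expR (2 * n * e ^+ 2) * (1 + z) ^+ n whatever F(x) is, and the maximal
    inequality for positive martingales (maximal_tilt) concludes. The opposite
    sign follows by reversing the order of the line.

    The maximal inequality is proved as a change of weights on configurations of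
    the samples in finitely many cells, cut out by finitely many thresholds;
    the thresholds then run through the rationals, and right-continuity
    reaches all reals. *)

(** * Bounds on the inverse hyperbolic tangent *)

Lemma derive_le_le (R : realType) (f f' g g' : R -> R) (b : R) : 0 <= b ->
  f 0 = g 0 ->
  (forall x, 0 <= x <= b -> is_derive x 1 f (f' x)) ->
  (forall x, 0 <= x <= b -> is_derive x 1 g (g' x)) ->
  (forall x, 0 <= x <= b -> f' x <= g' x) -> f b <= g b.
Proof.
move=> b0 fg0 df dg fg'.
have dh (x : R) : 0 <= x <= b -> is_derive x 1 (g - f) (g' x - f' x).
  by move=> xb; apply: is_deriveB; [exact: dg|exact: df].
have hc : {within `[0, b], continuous (g - f)}.
  apply: derivable_within_continuous => x; rewrite in_itv/= => xb.
  by have [] := dh x xb.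
have hd x : x \in `]0, b[ -> is_derive x 1 (g - f) (g' x - f' x).
  by rewrite in_itv/= => /andP[x0 xb]; apply: dh; rewrite !ltW.
have [c] := MVT_segment b0 hd hc.
rewrite in_itv/= !fctE fg0 subrr !subr0 => cb eq_b.
by rewrite -subr_ge0 eq_b mulr_ge0// subr_ge0 fg'.
Qed.

Lemma is_derive_monomial (R : realType) (c x : R) (n : nat) :
  is_derive x 1 (fun y : R => c * y ^+ n.+1) (c * n.+1%:R * x ^+ n).
Proof.
rewrite (_ : (fun y => _) = c \*: (id ^+ n.+1)); last first.
  by apply/funext => y; rewrite /= fctE.
apply: is_derive_eq (is_deriveZ c (is_deriveX n.+1 (is_derive_id x 1))) _.
by rewrite /GRing.scale/= mulr1 mulrA.
Qed.

Lemma is_derive_ln_ratio (R : realType) (x : R) : -1 < x < 1 ->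
  is_derive x 1 (fun y : R => ln (1 + y) - ln (1 - y)) (2 / (1 - x ^+ 2)).
Proof.
move=> /andP[x0 x1].
have x1p : 0 < 1 + x by lra.
have x1n : 0 < 1 - x by lra.
have d1 : is_derive x 1 (fun y : R => 1 + y) 1.
  rewrite (_ : (fun y => 1 + y) = cst 1 + id)//.
  by apply: is_derive_eq; rewrite add0r.
have d2 : is_derive x 1 (fun y : R => 1 - y) (- 1).
  rewrite (_ : (fun y => 1 - y) = cst 1 - id)//.
  by apply: is_derive_eq; rewrite add0r.
have dp : is_derive x 1 (@ln R \o (fun y => 1 + y)) ((1 + x)^-1 * 1).
  by apply: is_derive1_comp => //; exact: is_derive1_ln.
have dn : is_derive x 1 (@ln R \o (fun y => 1 - y)) ((1 - x)^-1 * -1).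
  by apply: is_derive1_comp => //; exact: is_derive1_ln.
rewrite (_ : (fun y => _) =
  (@ln R \o (fun y => 1 + y)) - (@ln R \o (fun y => 1 - y)))//.
apply: is_derive_eq.
have x2 : 1 - x ^+ 2 != 0 by rewrite gt_eqF//; nra.
by field; rewrite x2 !gt_eqF.
Qed.

(** The difference of logarithms is twice the inverse hyperbolic tangent of x,
    here truncated after four terms of its power series; with three terms the
    margin in tilt_gap_ge0_neg below would be lost for r close to 1. *)
Lemma ln_ratio_ge (R : realType) (x : R) : 0 <= x < 1 ->
  2 * (x + x ^+ 3 / 3 + x ^+ 5 / 5 + x ^+ 7 / 7) <= ln (1 + x) - ln (1 - x).
Proof.
move=> /andP[x0 x1].
pose f : R -> R := id + (fun y => 3^-1 * y ^+ 3) + (fun y => 5^-1 * y ^+ 5)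
  + (fun y => 7^-1 * y ^+ 7).
have df (y : R) : is_derive y 1 f (1 + y ^+ 2 + y ^+ 4 + y ^+ 6).
  apply: is_derive_eq (is_deriveD (is_deriveD (is_deriveD (is_derive_id y 1)
    (is_derive_monomial _ _ _)) (is_derive_monomial _ _ _))
    (is_derive_monomial _ _ _)) _.
  by field.
rewrite [leLHS](_ : _ = (2 \*: f) x); last first.
  by rewrite /f /= !fctE /GRing.scale/= /cst; field.
apply: (derive_le_le x0 _ (fun y _ => is_deriveZ 2 (df y))
                          (fun y _ => is_derive_ln_ratio _)).
- by rewrite /f !fctE/= addr0 subr0 subrr !expr0n/= !(mulr0, addr0) scaler0.
- by move=> y /andP[y0 yx]; lra.
move=> y /andP[y0 yx].
have y2 : 0 < 1 - y ^+ 2 by nra.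
rewrite ler_pdivlMr// /GRing.scale/=.
rewrite [leLHS](_ : _ = 2 - 2 * y ^+ 8); last by ring.
by rewrite gerBl mulr_ge0// exprn_ge0.
Qed.

(** The series of the inverse hyperbolic tangent beyond its first term is at
    most the geometric series with first term x ^+ 3 / 3 and ratio x ^+ 2. *)
Lemma ln_ratio_le (R : realType) (x : R) : 0 <= x < 1 ->
  ln (1 + x) - ln (1 - x) <= 2 * (x + x ^+ 3 / (3 * (1 - x ^+ 2))).
Proof.
move=> /andP[x0 x1].
have pos (y : R) : 0 <= y <= x -> 0 < 1 - y ^+ 2.
  by move=> /andP[y0 yx]; nra.
pose g : R -> R :=
  (2 / 3) \*: id + 3^-1 \*: (id * (fun y => (1 - y ^+ 2)^-1)).
have dg (y : R) : 0 <= y <= x ->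
    is_derive y 1 g (2 / 3 + 3^-1 * ((1 + y ^+ 2) / (1 - y ^+ 2) ^+ 2)).
  move=> /pos y2.
  have dq : is_derive y 1 (fun z : R => 1 - z ^+ 2) (- (2 * y)).
    rewrite (_ : (fun z => _) = cst 1 - id ^+ 2)//.
    by apply: is_derive_eq; rewrite /GRing.scale/=; ring.
  have dv := @is_deriveV _ (fun z => 1 - z ^+ 2) y _ _ (lt0r_neq0 y2) dq.
  apply: is_derive_eq (is_deriveD (is_deriveZ _ (is_derive_id y 1))
    (is_deriveZ _ (is_deriveM (is_derive_id y 1) dv))) _.
  by rewrite /GRing.scale/=; field; rewrite gt_eqF.
rewrite [leRHS](_ : _ = (2 \*: g) x); last first.
  rewrite [RHS](_ : _ = 2 * (2 / 3 * x + 3^-1 * (x / (1 - x ^+ 2))))//.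
  by field; rewrite gt_eqF// pos// x0 lexx.
apply: (derive_le_le x0 _ (fun y _ => is_derive_ln_ratio _)
   (fun y yx => is_deriveZ 2 (dg y yx))).
- by rewrite /g !fctE/= addr0 subr0 subrr mul0r !scaler0 addr0 scaler0.
- by move=> y /andP[y0 yx]; lra.
move=> y yx; have y2 := pos y yx.
rewrite -subr_ge0 /GRing.scale/=.
rewrite [leRHS](_ : _ = (4 / 3) * y ^+ 4 / (1 - y ^+ 2) ^+ 2); last first.
  by field; rewrite gt_eqF.
have y0 : 0 <= y by case/andP: yx.
apply: divr_ge0; last by rewrite exprn_ge0// ltW.
by apply: mulr_ge0; [lra | exact: exprn_ge0].
Qed.

(** The constant 2 / 5 comes from the quintic bound with coefficient 4 / 15,
    valid by comparison of derivatives on [0, 1/2]: there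
    1 / 3 + 4 / 15 * x ^+ 2 is at most 2 / 5. *)
Lemma ln_ratio_le_half (R : realType) (x : R) : 0 <= x <= 1 / 2 ->
  ln (1 + x) - ln (1 - x) <= 2 * (x + 2 / 5 * x ^+ 3).
Proof.
move=> /andP[x0 x1].
pose g : R -> R :=
  id + (fun y => 3^-1 * y ^+ 3) + (fun y => 4 / 15 * y ^+ 5).
have dg (y : R) : is_derive y 1 g (1 + y ^+ 2 + 4 / 3 * y ^+ 4).
  apply: is_derive_eq (is_deriveD (is_deriveD (is_derive_id y 1)
    (is_derive_monomial _ _ _)) (is_derive_monomial _ _ _)) _.
  by field.
apply: (@le_trans _ _ ((2 \*: g) x)).
  apply: (derive_le_le x0 _ (fun y _ => is_derive_ln_ratio _)
                            (fun y _ => is_deriveZ 2 (dg y))).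
  - by rewrite /g !fctE/= addr0 subr0 subrr !expr0n/= !(mulr0, addr0) scaler0.
  - by move=> y /andP[y0 yx]; lra.
  move=> y /andP[y0 yx].
  have y2 : y ^+ 2 <= 1 / 4 by nra.
  have y2p : 0 < 1 - y ^+ 2 by lra.
  rewrite ler_pdivrMr// /GRing.scale/=.
  rewrite -subr_ge0 [leRHS](_ : _ = 2 / 3 * y ^+ 4 * (1 - 4 * y ^+ 2)); last by field.
  by rewrite !mulr_ge0 ?exprn_ge0//; lra.
rewrite /g /= !fctE /GRing.scale/= /cst ler_pM2l// -addrA lerD2l.
have x2 : x ^+ 2 <= 1 / 4 by nra.
rewrite -subr_ge0 [leRHS](_ : _ = x ^+ 3 * (1 / 15 - 4 / 15 * x ^+ 2)); last by field.
by rewrite mulr_ge0 ?exprn_ge0//; lra.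
Qed.

(** * A single exponential tilt for all levels *)

Section TiltPolynomial.
Variable R : realFieldType.
Implicit Types r s t L a : R.

(** The deviation e served by the tilt of size 2 * r / (1 - r). Matching the
    terms of order two and three in exponential_tilt forces
    e = r - r ^+ 2 / 3 + O(r ^+ 3); the cubic term makes the map send [0, 1]
    onto itself. *)
Definition tilt_level r := r - r ^+ 2 * (1 - r) / 3.

(** Up to a positive factor, the margin in the inequality of exponential_tilt,
    after the change of variable that trades the population mass for s: the
    point s = 0 is where 1 + z / m is the square of 1 + z, and L and a stand
    for the inverse hyperbolic tangents of r and s. *)
Definition tilt_gap r s L a :=
  (2 * r * (1 - r) * (1 - s) + (2 * tilt_level r - 1) * (2 * r + s * (1 + r ^+ 2)))
    * L
  + (r * (1 - r) * (1 - s) + tilt_level r * (2 * r + s * (1 + r ^+ 2))) * a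
  - tilt_level r ^+ 2 * (2 * r + s * (1 + r ^+ 2)).

Lemma powers_decr r : 0 <= r <= 1 ->
  forall k : nat, 0 <= r ^+ k.+1 <= r ^+ k.
Proof.
move=> /andP[r0 r1] k; rewrite exprn_ge0//= exprS.
by rewrite ler_piMl// exprn_ge0.
Qed.

(** For s >= 0, expanding in powers of s leaves coefficients whose low-order
    terms in r visibly dominate the few negative monomials on 0 <= r <= 1; the
    same happens with the upper bound on L. *)
Lemma tilt_gap_ge0_Llo r s : 0 <= r <= 1 -> 0 <= s ->
  0 <= tilt_gap r s (r + r ^+ 3 / 3) (s + s ^+ 3 / 3).
Proof.
move=> r01 s0; have r0 : 0 <= r by case/andP: r01.
have P := powers_decr r01.
rewrite [leRHS](_ : _ =
    r ^+ 5 * (4 / 9 + 2 / 9 * r ^+ 2)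
  + s * r ^+ 4 * (14 / 9 + 1 / 3 * r + 2 / 3 * r ^+ 2 + 1 / 9 * r ^+ 4)
  + s ^+ 2 * r ^+ 2 * (2 / 3 + 4 / 3 * r - 1 / 3 * r ^+ 2 + 1 / 3 * r ^+ 3)
  + s ^+ 3 * r * (1 / 3 + 1 / 3 * r - 2 / 9 * r ^+ 2 + 2 / 9 * r ^+ 3)
  + s ^+ 4 * r ^+ 2 * (2 / 9 + 4 / 9 * r - 1 / 9 * r ^+ 2 + 1 / 9 * r ^+ 3));
  last by rewrite /tilt_gap /tilt_level; field.
have := (P 0, P 1, P 2, P 3)%N; rewrite expr0 expr1 => -[[[P0 P1] P2] P3].
by rewrite !addr_ge0// !mulr_ge0 ?exprn_ge0//; lra.
Qed.

Lemma tilt_gap_ge0_Lup r s : 0 <= r < 1 -> 0 <= s ->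
  0 <= tilt_gap r s (r + r ^+ 3 / (3 * (1 - r ^+ 2))) (s + s ^+ 3 / 3).
Proof.
move=> /andP[r0 r1] s0.
have r01 : 0 <= r <= 1 by rewrite r0 ltW.
have P := powers_decr r01.
have r2 : 0 < 1 - r ^+ 2 by nra.
rewrite [leRHS](_ : _ =
   (r ^+ 5 * (4 / 9 + 4 / 9 * r ^+ 2 - 4 / 9 * r ^+ 3 + 2 / 9 * r ^+ 4)
  + s * r ^+ 4 * (14 / 9 - 8 / 9 * r ^+ 2 - 2 / 9 * r ^+ 3 + 1 / 3 * r ^+ 4
                  - 2 / 9 * r ^+ 5 + 1 / 9 * r ^+ 6)
  + s ^+ 2 * r ^+ 2 * (2 / 3 + 4 / 3 * r - r ^+ 2 - r ^+ 3 + 1 / 3 * r ^+ 4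
                       - 1 / 3 * r ^+ 5)
  + s ^+ 3 * r * (1 / 3 + 1 / 3 * r - 5 / 9 * r ^+ 2 - 1 / 9 * r ^+ 3
                  + 2 / 9 * r ^+ 4 - 2 / 9 * r ^+ 5)
  + s ^+ 4 * r ^+ 2 * (2 / 9 + 4 / 9 * r - 1 / 3 * r ^+ 2 - 1 / 3 * r ^+ 3
                       + 1 / 9 * r ^+ 4 - 1 / 9 * r ^+ 5)) / (1 - r ^+ 2));
  last by rewrite /tilt_gap /tilt_level; field; rewrite gt_eqF.
apply: divr_ge0; last exact: ltW.
have := (P 0, P 1, P 2, P 3, P 4, P 5)%N; rewrite expr0 expr1.
move=> -[[[[[P0 P1] P2] P3] P4] P5].
by rewrite !addr_ge0// !mulr_ge0 ?exprn_ge0//; lra.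
Qed.

(** For s = - t <= 0 the expansion in powers of t has negative coefficients,
    but t * (1 + r) ranges over [0, r] only: in the Bernstein basis of that
    interval, that is in the monomials of u = t * (1 + r) and w = r - u, all
    five coefficients are nonnegative for 0 <= r <= 1. *)
Lemma tilt_gap_ge0_neg r t : 0 <= r <= 1 -> 0 <= t -> t * (1 + r) <= r ->
  0 <= tilt_gap r (- t) (r + r ^+ 3 / 3 + r ^+ 5 / 5 + r ^+ 7 / 7)
         (- (t + 2 / 5 * t ^+ 3)).
Proof.
move=> r01 t0 tr; have r0 : 0 <= r by case/andP: r01.
have r1 : 0 <= 1 - r by rewrite subr_ge0; case/andP: r01.
have P := powers_decr r01.
pose u := t * (1 + r); pose w := r - u.
have u0 : 0 <= u by rewrite mulr_ge0// addr_ge0.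
have w0 : 0 <= w by rewrite subr_ge0.
rewrite -(@pmulr_rge0 _ ((1 + r) ^+ 4)); last by rewrite exprn_gt0// ltr_wpDr.
rewrite [leRHS](_ : _ =
    (4 / 9 * r + 16 / 9 * r ^+ 2 + 148 / 45 * r ^+ 3 + 4 * r ^+ 4
      + 1154 / 315 * r ^+ 5 + 916 / 315 * r ^+ 6 + 724 / 315 * r ^+ 7
      + 164 / 105 * r ^+ 8 + 14 / 15 * r ^+ 9 + 4 / 7 * r ^+ 10
      + 4 / 21 * r ^+ 11) * w ^+ 4
  + 4 * (1 / 18 * r + 26 / 45 * r ^+ 2 + 167 / 90 * r ^+ 3
      + 1909 / 630 * r ^+ 4 + 1271 / 420 * r ^+ 5 + 736 / 315 * r ^+ 6
      + 223 / 126 * r ^+ 7 + 139 / 126 * r ^+ 8 + 37 / 60 * r ^+ 9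
      + 31 / 70 * r ^+ 10 + 1 / 7 * r ^+ 11 - 1 / 42 * r ^+ 12) * (u * w ^+ 3)
  + 6 * (1 / 9 + 1 / 9 * r - 11 / 90 * r ^+ 2 + 53 / 90 * r ^+ 3
      + 1333 / 630 * r ^+ 4 + 22 / 9 * r ^+ 5 + 556 / 315 * r ^+ 6
      + 391 / 315 * r ^+ 7 + 29 / 45 * r ^+ 8 + 3 / 10 * r ^+ 9
      + 11 / 35 * r ^+ 10 + 2 / 21 * r ^+ 11 - 1 / 21 * r ^+ 12)
      * (u ^+ 2 * w ^+ 2)
  + 4 * (7 / 30 + 37 / 90 * r - 16 / 45 * r ^+ 2 - 23 / 45 * r ^+ 3
      + 25 / 21 * r ^+ 4 + 2417 / 1260 * r ^+ 5 + 376 / 315 * r ^+ 6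
      + 449 / 630 * r ^+ 7 + 13 / 70 * r ^+ 8 - 1 / 60 * r ^+ 9
      + 13 / 70 * r ^+ 10 + 1 / 21 * r ^+ 11 - 1 / 14 * r ^+ 12)
      * (u ^+ 3 * w)
  + (4 / 15 + 34 / 45 * r + 1 / 9 * r ^+ 2 - 41 / 45 * r ^+ 3
      + 17 / 315 * r ^+ 4 + 166 / 105 * r ^+ 5 + 28 / 45 * r ^+ 6
      + 58 / 315 * r ^+ 7 - 86 / 315 * r ^+ 8 - 1 / 3 * r ^+ 9
      + 2 / 35 * r ^+ 10 - 2 / 21 * r ^+ 12) * u ^+ 4); last first.
  by rewrite /tilt_gap /tilt_level /w /u; field.
have := (P 1, P 2, P 3, P 4, P 5, P 6, P 7, P 8, P 9, P 10, P 11)%N.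
rewrite expr1 => -[[[[[[[[[[P1 P2] P3] P4] P5] P6] P7] P8] P9] P10] P11].
(* The coefficient of u ^+ 3 * w has a negative partial sum; this inequality
   spreads its cubic term over the two neighbouring degrees. *)
have Q2 : 0 <= r ^+ 2 - 2 * r ^+ 3 + r ^+ 4.
  rewrite [leRHS](_ : _ = r ^+ 2 * (1 - r) ^+ 2); last by ring.
  by rewrite mulr_ge0 ?exprn_ge0.
have uw i j : 0 <= u ^+ i * w ^+ j by rewrite mulr_ge0 ?exprn_ge0.
apply: addr_ge0; [apply: addr_ge0; [apply: addr_ge0;
  [apply: addr_ge0|]|]|].
all: apply: mulr_ge0.
- by clear -r1 P1 P2 P3 P4 P5 P6 P7 P8 P9 P10 P11 Q2; lra.
- exact: exprn_ge0.
- apply: mulr_ge0; first exact: ler0n.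
  by clear -r1 P1 P2 P3 P4 P5 P6 P7 P8 P9 P10 P11 Q2; lra.
- exact: (uw 1%N 3%N).
- apply: mulr_ge0; first exact: ler0n.
  by clear -r1 P1 P2 P3 P4 P5 P6 P7 P8 P9 P10 P11 Q2; lra.
- exact: uw.
- apply: mulr_ge0; first exact: ler0n.
  by clear -r1 P1 P2 P3 P4 P5 P6 P7 P8 P9 P10 P11 Q2; lra.
- exact: (uw 3%N 1%N).
- by clear -r1 P1 P2 P3 P4 P5 P6 P7 P8 P9 P10 P11 Q2; lra.
- exact: exprn_ge0.
Qed.
End TiltPolynomial.

Lemma tilt_level_onto (R : realType) (e : R) : 0 < e < 1 ->
  exists2 r : R, 0 < r < 1 & tilt_level r = e.
Proof.
move=> /andP[e0 e1].
have [p pE] : exists p : {poly R}, forall r, p.[r] = tilt_level r.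
  exists ('X - 3^-1 *: ('X^2 * (1%:P - 'X))) => r; rewrite /tilt_level.
  by rewrite !(hornerD, hornerN, hornerZ, hornerM, hornerXn, hornerX, hornerC); field.
have [||r] := @poly_ivt R (p - e%:P) 0 1; rewrite ?ler01//.
  by rewrite !(hornerD, hornerN, hornerC) !pE /tilt_level; apply/andP; split; lra.
move=> /andP[r0 r1] /rootP.
rewrite !(hornerD, hornerN, hornerC) pE => /eqP; rewrite subr_eq0 => /eqP re.
exists r => //; rewrite !lt_neqAle r0 r1 !andbT.
apply/andP; split; apply/eqP => rE; move: re; rewrite /tilt_level.
  by rewrite -rE; lra.
by rewrite rE; lra.
Qed.

Lemma tilt_gapD (R : realFieldType) (r s L L' a a' : R) :
  tilt_gap r s L' a' = tilt_gap r s L a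
    + (2 * r * (1 - r) * (1 - s) + (2 * tilt_level r - 1) * (2 * r + s * (1 + r ^+ 2)))
      * (L' - L)
    + (r * (1 - r) * (1 - s) + tilt_level r * (2 * r + s * (1 + r ^+ 2))) * (a' - a).
Proof. by rewrite /tilt_gap; ring. Qed.

(** The margin is affine in L and in a, with a nonnegative slope in a, so the
    logarithms can be replaced by their rational bounds. For s >= 0 the slope in
    L has no fixed sign, which is why both bounds on L are tested; for s < 0 it
    is nonnegative. *)
Lemma tilt_gap_ge0 (R : realType) (r s : R) : 0 < r < 1 -> -1 < s < 1 ->
  (s < 0 -> - s * (1 + r) <= r) ->
  0 <= tilt_gap r s ((ln (1 + r) - ln (1 - r)) / 2)
                    ((ln (1 + s) - ln (1 - s)) / 2).
Proof.
move=> /andP[r0 r1] /andP[s0 s1] sr.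
have r01 : 0 <= r <= 1 by rewrite !ltW.
set L := _ / 2; set a := _ / 2.
have r2 : 0 < 1 - r ^+ 2 by nra.
have Llo : r + r ^+ 3 / 3 + r ^+ 5 / 5 + r ^+ 7 / 7 <= L.
  by rewrite ler_pdivlMr// mulrC ln_ratio_ge// r1 ltW.
have Lup : L <= r + r ^+ 3 / (3 * (1 - r ^+ 2)).
  by rewrite ler_pdivrMr// mulrC ln_ratio_le// r1 ltW.
have er : r <= 2 * tilt_level r.
  rewrite /tilt_level -subr_ge0.
  rewrite [leRHS](_ : _ = r / 3 * (2 * (1 - r) + 1 + 2 * r ^+ 2)).
    by nra.
  by field.
have [s_lt0|s_ge0] := ltP s 0.
  have hs := sr s_lt0.
  have t2 : 0 <= - s <= 1 / 2 by nra.
  have ha : - (- s + 2 / 5 * (- s) ^+ 3) <= a.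
    rewrite lerNl /a -mulNr opprB ler_pdivrMr// mulrC.
    by have := ln_ratio_le_half t2; rewrite opprK.
  have t0 : 0 <= - s by case/andP: t2.
  have := tilt_gap_ge0_neg r01 t0 hs; rewrite opprK => gap0.
  have B0 : 0 <= 2 * r + s * (1 + r ^+ 2) by nra.
  rewrite (tilt_gapD r s (r + r ^+ 3 / 3 + r ^+ 5 / 5 + r ^+ 7 / 7) L
             (- (- s + 2 / 5 * (- s) ^+ 3)) a).
  apply: addr_ge0; [apply: addr_ge0|]; first exact: gap0.
    apply: mulr_ge0; last by rewrite subr_ge0.
    rewrite [leRHS](_ : _ = (2 * tilt_level r - r) * (2 * r + s * (1 + r ^+ 2))
                   + - s * (1 + r) * (1 - r ^+ 2)); last by ring.
    by rewrite addr_ge0 ?mulr_ge0//; lra.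
  by rewrite mulr_ge0 ?subr_ge0// addr_ge0 ?mulr_ge0//; lra.
have B0 : 0 <= 2 * r + s * (1 + r ^+ 2) by nra.
have ha : s + s ^+ 3 / 3 <= a.
  rewrite ler_pdivlMr// mulrC; apply: le_trans (ln_ratio_ge _); last by rewrite s_ge0.
  by rewrite ler_pM2l// -[leLHS]addr0 -!addrA !lerD// addr_ge0// divr_ge0// exprn_ge0.
have Llo3 : r + r ^+ 3 / 3 <= L.
  apply: le_trans Llo; rewrite -[leLHS]addr0 -!addrA !lerD//.
  by rewrite addr_ge0// divr_ge0// exprn_ge0// ltW.
have C0 : 0 <= r * (1 - r) * (1 - s) + tilt_level r * (2 * r + s * (1 + r ^+ 2)).
  by rewrite addr_ge0 ?mulr_ge0//; lra.
have [K0|K0] := leP 0 (2 * r * (1 - r) * (1 - s)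
                  + (2 * tilt_level r - 1) * (2 * r + s * (1 + r ^+ 2))).
  rewrite (tilt_gapD r s (r + r ^+ 3 / 3) L (s + s ^+ 3 / 3) a).
  apply: addr_ge0; [apply: addr_ge0|]; first exact: tilt_gap_ge0_Llo.
    by rewrite mulr_ge0// subr_ge0.
  by rewrite mulr_ge0// subr_ge0.
rewrite (tilt_gapD r s (r + r ^+ 3 / (3 * (1 - r ^+ 2))) L (s + s ^+ 3 / 3) a).
apply: addr_ge0; [apply: addr_ge0|].
- by apply: tilt_gap_ge0_Lup => //; rewrite r1 ltW.
- by rewrite mulr_le0 ?(ltW K0)// subr_le0.
- by rewrite mulr_ge0// subr_ge0.
Qed.

(** The analytic heart of the proof: one tilt z, depending on e alone, works for
    every population mass m. For a single m the best tilt gives the relative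
    entropy of m + e with respect to m, which is at least 2 * e ^+ 2 by
    Pinsker's inequality; but that tilt depends on m, and a union over m would
    cost a factor. For small e, the part of order two of
    (m + e) * ln (1 + z / m) - ln (1 + z) is 2 * e ^+ 2 for every m as soon as
    z = 2 * e + O(e ^+ 2), and the part of order three has minimum 0 over m
    exactly when z = 2 * e + 8 / 3 * e ^+ 2 + O(e ^+ 3); the part of order four
    is then positive at that minimum. *)
Lemma exponential_tilt (R : realType) (e : R) : 0 < e ->
  exists2 z : R, 0 < z & forall m : R, 0 < m -> m + e <= 1 ->
    2 * e ^+ 2 + ln (1 + z) <= (m + e) * ln (1 + z / m).
Proof.
move=> e0; have [e1|e1] := leP 1 e.
  by exists 1 => // m m0 me; exfalso; lra.
have [|r /andP[r0 r1] re] := @tilt_level_onto R e; first by rewrite e0.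
have r1p : 0 < 1 - r by lra.
have r2p : 0 < 1 + r by lra.
have rr : 0 < r * (1 - r) by rewrite mulr_gt0.
exists (2 * r / (1 - r)); first by rewrite divr_gt0// mulr_gt0.
move=> m m0 me.
have D0 : 0 < m * (1 + r ^+ 2) + r * (1 - r).
  by rewrite addr_gt0// mulr_gt0// ltr_pwDl// exprn_ge0// ltW.
(* Chosen so that (1 + s) / (1 - s) is the quotient of 1 + z / m by the square
   of 1 + z. *)
pose s := (r * (1 - r) - 2 * r * m) / (m * (1 + r ^+ 2) + r * (1 - r)).
have s1 : 1 - s = m * (1 + r) ^+ 2 / (m * (1 + r ^+ 2) + r * (1 - r)).
  by rewrite /s; field; rewrite gt_eqF.
have s2 : 1 + s = (1 - r) * (m * (1 - r) + 2 * r) / (m * (1 + r ^+ 2) + r * (1 - r)).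
  by rewrite /s; field; rewrite gt_eqF.
have mr0 : 0 < m * (1 - r) + 2 * r by rewrite addr_gt0 ?mulr_gt0.
have s1p : 0 < 1 - s by rewrite s1 divr_gt0// mulr_gt0// exprn_gt0.
have s2p : 0 < 1 + s by rewrite s2 divr_gt0// mulr_gt0.
have BE : 2 * r + s * (1 + r ^+ 2)
    = r * (1 - r) * (1 + r) ^+ 2 / (m * (1 + r ^+ 2) + r * (1 - r)).
  by rewrite /s; field; rewrite gt_eqF.
have B0 : 0 < 2 * r + s * (1 + r ^+ 2).
  by rewrite BE divr_gt0// mulr_gt0// exprn_gt0.
have mB : r * (1 - r) * (1 - s) = m * (2 * r + s * (1 + r ^+ 2)).
  by rewrite s1 BE; field; rewrite gt_eqF.
(* As s decreases in m, the bound m <= 1 - e limits - s. *)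
have sr : s < 0 -> - s * (1 + r) <= r.
  move=> _; rewrite /s -mulNr mulrAC ler_pdivrMr//.
  have mr : m <= (1 - r) * (1 + r ^+ 2 / 3) by move: me; rewrite -re /tilt_level; lra.
  rewrite -subr_ge0 [leRHS](_ : _ =
    r * ((1 - r) * (1 + 2 * r) - m * (1 + 2 * r - r ^+ 2))); last by ring.
  rewrite mulr_ge0 ?(ltW r0)// subr_ge0.
  have q0 : 0 <= 1 + 2 * r - r ^+ 2 by nra.
  apply: le_trans (ler_wpM2r q0 mr) _.
  rewrite -subr_ge0 [leRHS](_ : _ =
    (1 - r) * r ^+ 2 * ((1 - r) ^+ 2 + 1) / 3); last by field.
  apply: divr_ge0 => //; apply: mulr_ge0.
    by rewrite mulr_ge0 ?exprn_ge0 ?ltW.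
  by rewrite addr_ge0// exprn_ge0// ltW.
have gap : 0 <= tilt_gap r s ((ln (1 + r) - ln (1 - r)) / 2)
                    ((ln (1 + s) - ln (1 - s)) / 2).
  apply: tilt_gap_ge0; [by rewrite r0 | apply/andP; split; lra | exact: sr].
have -> : 1 + 2 * r / (1 - r) = (1 + r) / (1 - r) by field; rewrite gt_eqF.
have -> : 1 + 2 * r / (1 - r) / m
    = ((1 + r) / (1 - r)) ^+ 2 * ((1 + s) / (1 - s)).
  by rewrite s1 s2; field; rewrite !gt_eqF.
have lr : ln ((1 + r) / (1 - r)) = ln (1 + r) - ln (1 - r).
  by rewrite ln_div ?posrE.
rewrite [X in _ <= _ * X]lnM ?posrE ?exprn_gt0 ?divr_gt0//.
rewrite lnXn ?divr_gt0// lr ln_div ?posrE//.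
move: gap; rewrite /tilt_gap.
move: (ln (1 + r) - ln (1 - r)) (ln (1 + s) - ln (1 - s)) => l a.
have -> : 2 * r * (1 - r) * (1 - s) = 2 * (m * (2 * r + s * (1 + r ^+ 2))).
  by rewrite -mB; ring.
rewrite mB re => gap.
rewrite -subr_ge0 -(@pmulr_rge0 _ (2 * r + s * (1 + r ^+ 2)))//.
set G := (X in 0 <= X) in gap.
by rewrite [leRHS](_ : _ = 2 * G) ?mulr_ge0// /G; field.
Qed.

(** * A maximal inequality for tilted finite configurations *)

Section MaximalTilt.
Variables (R : realFieldType) (C : finType) (key : C -> nat) (n M : nat).
Variable hit : nat -> nat -> bool.
Implicit Types (f g : {ffun 'I_n -> C}) (q v : C -> R).

Definition below (m : nat) f : nat := #|[set j | (key (f j) < m)%N]%SET|.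

(** Going down the levels, the first hit met is a stopping time: whether it occurs
    at m depends only on which samples lie below m and on the cells of the
    others. *)
Definition hit_last (m : 'I_M.+1) f : bool :=
  hit m (below m f) && [forall m' : 'I_M.+1, (m < m')%N ==> ~~ hit m' (below m' f)].

Definition mass q (m : nat) : R := \sum_(c | (key c < m)%N) q c.

Lemma hit_last_uniq f m1 m2 : hit_last m1 f -> hit_last m2 f -> m1 = m2.
Proof.
move=> /andP[h1 /forallP l1] /andP[h2 /forallP l2]; apply: val_inj => /=.
by case: (ltngtP m1 m2) => // lt12;
  [have := l1 m2|have := l2 m1]; rewrite lt12/= ?h1 ?h2.
Qed.

Lemma hit_lastP f :
  reflect (exists m, hit_last m f) [exists m : 'I_M.+1, hit m (below m f)].
Proof.
apply: (iffP existsP) => [[m0 hm0]|[m /andP[hm _]]]; last by exists m.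
have [m hm mmax] := @arg_maxnP _ m0 (fun m => hit m (below m f))
  (fun m : 'I_M.+1 => m : nat) hm0.
exists m; rewrite /hit_last hm; apply/forallP => m'; apply/implyP => mm'.
by apply/negP => /mmax; rewrite /= leqNgt mm'.
Qed.

Lemma sum_hit_last (F : {ffun 'I_n -> C} -> R) :
  \sum_(f | [exists m : 'I_M.+1, hit m (below m f)]) F f
  = \sum_(m < M.+1) \sum_(f | hit_last m f) F f.
Proof.
rewrite (partition_big (fun f => odflt ord0 [pick m | hit_last m f]) xpredT)//=.
apply: eq_bigr => m _; apply: eq_bigl => f.
apply/andP/idP => [[/hit_lastP[m0 hm0]]|hm].
  by case: pickP => [m1 hm1 /eqP <-|/(_ m0)]; rewrite ?hm0.
split; first by apply/hit_lastP; exists m.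
by case: pickP => [m1 hm1|/(_ m)]; [rewrite (hit_last_uniq hm1 hm)|rewrite hm].
Qed.

(** The optional stopping step: a map phi that moves samples only below m does not
    affect whether the last hit is at m, so the weights can be pushed forward
    along phi. *)
Lemma sum_collapse (phi : C -> C) (m : 'I_M.+1) v :
  (forall c (m' : nat), (m <= m')%N -> (key (phi c) < m')%N = (key c < m')%N) ->
  \sum_(f | hit_last m f) \prod_j v (f j)
  = \sum_(g | hit_last m g) \prod_j \sum_(c | phi c == g j) v c.
Proof.
move=> phiP.
have belowE f (m' : nat) : (m <= m')%N ->
    below m' [ffun j => phi (f j)] = below m' f.
  move=> mm'; rewrite /below; apply: eq_card => j.
  by rewrite !inE ffunE phiP.
have lastE f : hit_last m [ffun j => phi (f j)] = hit_last m f.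
  rewrite /hit_last belowE//; congr (_ && _).
  apply: eq_forallb => m'; case: (ltnP m m') => //= mm'.
  by rewrite belowE// ltnW.
rewrite (partition_big (fun f => [ffun j => phi (f j)]) (hit_last m));
  last by move=> f; rewrite lastE.
apply: eq_bigr => g gm.
rewrite bigA_distr_big_dep; apply: eq_bigl => f.
apply/andP/familyP => [[_ /eqP <-] j|fam].
  by rewrite unfold_in/= ffunE.
have fE : [ffun j => phi (f j)] = g.
  by apply/ffunP => j; rewrite ffunE; apply/eqP; exact: fam.
by rewrite -lastE fE.
Qed.

(** Doob's maximal inequality for the likelihood ratio of an exponential tilt.
    Adding the weight z to a lowest cell multiplies, on the event that the last
    hit is at m, the merged weight mass ^+ k of the k samples below m by
    ((mass + z) / mass) ^+ k >= lam and keeps the weight of the others. These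
    events are disjoint and the tilted weights of all configurations add up to
    (1 + z) ^+ n when q is a probability. *)
Lemma maximal_tilt q (lam z : R) : (forall c, 0 <= q c) -> 0 <= z ->
  (forall m, ~~ hit m 0) ->
  (forall m k, (k <= n)%N -> hit m k ->
    lam * mass q m ^+ k <= (mass q m + z) ^+ k) ->
  lam * (\sum_(f : {ffun 'I_n -> C} | [exists m : 'I_M.+1, hit m (below m f)])
           \prod_j q (f j)) <= (\sum_c q c + z) ^+ n.
Proof.
move=> q0 z0 hit0 hit_lam.
have [c1 _|C0] := pickP C; last first.
  rewrite big_pred0 ?mulr0 ?exprn_ge0 ?addr_ge0 ?sumr_ge0// => f.
  apply/existsP => -[m]; apply/negP; rewrite (_ : below m f = 0%N) ?hit0//.
  by apply/eqP; rewrite cards_eq0; apply/eqP/setP => j; have := C0 (f j).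
have [c0 _ key_min] := @arg_minnP _ c1 predT key isT.
pose q' c := q c + (if c == c0 then z else 0).
have q'0 c : 0 <= q' c by rewrite addr_ge0//; case: ifP.
have sum_q' (P : pred C) : P c0 -> \sum_(c | P c) q' c = \sum_(c | P c) q c + z.
  move=> Pc0; rewrite big_split/= -big_mkcondr/=; congr (_ + _).
  by rewrite (big_pred1 c0)// => c; rewrite /= andbC; case: eqVneq => // ->.
rewrite -sum_q'// -[X in _ ^+ X]card_ord -prodr_const bigA_distr_bigA/=.
apply: (@le_trans _ _ (\sum_(f | [exists m : 'I_M.+1, hit m (below m f)])
                         \prod_j q' (f j))); last first.
  rewrite [leRHS](bigID (fun f => [exists m : 'I_M.+1, hit m (below m f)]))/=.
  by rewrite lerDl sumr_ge0// => f _; exact: prodr_ge0.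
rewrite !sum_hit_last mulr_sumr ler_sum// => m _.
have [c0m|mc0] := ltnP (key c0) m; last first.
  have no_hit f : hit_last m f = false.
    apply/negbTE/nandP; left; rewrite (_ : below m f = 0%N)//.
    apply/eqP; rewrite cards_eq0; apply/eqP/setP => j; rewrite !inE.
    by apply/negbTE; rewrite -leqNgt (leq_trans mc0)// key_min.
  by rewrite !big_pred0// mulr0.
pose phi c := if (key c < m)%N then c0 else c.
have phiP c (m' : nat) : (m <= m')%N -> (key (phi c) < m')%N = (key c < m')%N.
  rewrite /phi => mm'; case: ifPn => // cm.
  by rewrite (leq_trans c0m mm') (leq_trans cm mm').
rewrite !(sum_collapse _ phiP) mulr_sumr ler_sum// => g /andP[hm _].
(* The fibre of phi over c0 is everything below m; over another cell below m
   it is empty. *)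
have fib (v : C -> R) (d : C) : \sum_(c | phi c == d) v c
    = if (key d < m)%N then (if d == c0 then mass v m else 0) else v d.
  have [dm|md] := ltnP (key d) m.
    have [->|dc0] := eqVneq d c0.
      apply: eq_bigl => c; rewrite /phi; case: ifPn => [_|cm]; first exact: eqxx.
      by apply/eqP => cc0; rewrite cc0 c0m in cm.
    rewrite big_pred0// => c; rewrite /phi; case: ifPn => cm.
      by rewrite eq_sym (negbTE dc0).
    by apply/eqP => cd; rewrite cd dm in cm.
  rewrite (big_pred1 d)// => c; rewrite /= /phi; case: ifPn => // cm.
  have cd (x : C) : (key x < m)%N -> (x == d) = false.
    by move=> xm; apply/eqP => xd; rewrite xd ltnNge md in xm.
  by rewrite !cd.
under eq_bigr do rewrite fib.
under [leRHS]eq_bigr do rewrite fib.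
have split_below (v : C -> R) (a : R) :
    \prod_j (if (key (g j) < m)%N then (if g j == c0 then a else 0) else v (g j))
  = (\prod_(j | (key (g j) < m)%N) (if g j == c0 then a else 0))
    * \prod_(j | ~~ (key (g j) < m)%N) v (g j).
  rewrite (bigID (fun j => (key (g j) < m)%N))/=; congr (_ * _).
    by apply: eq_bigr => j ->.
  by apply: eq_bigr => j /negbTE ->.
rewrite !split_below.
have -> : \prod_(j | ~~ (key (g j) < m)%N) q' (g j)
        = \prod_(j | ~~ (key (g j) < m)%N) q (g j).
  apply: eq_bigr => j gm; rewrite /q'; case: eqP => [gc|]; last by rewrite addr0.
  by rewrite gc c0m in gm.
rewrite mulrA ler_wpM2r ?prodr_ge0//.
have [/existsP[j /andP[gm gc]]|/existsPn all_c0] :=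
    boolP [exists j, (key (g j) < m)%N && (g j != c0)].
  by rewrite (bigD1 j)//= (negbTE gc) mul0r mulr0 prodr_ge0// => i _;
    case: ifP => // _; exact: sumr_ge0.
have prodE (a : R) :
    \prod_(j | (key (g j) < m)%N) (if g j == c0 then a else 0) = a ^+ below m g.
  rewrite /below -prodr_const; apply: eq_big => [j|j gm]; first by rewrite inE.
  by have := all_c0 j; rewrite gm/= negbK => ->.
rewrite !prodE /mass sum_q'//.
apply: hit_lam hm; rewrite -[leqRHS]card_ord; exact: max_card.
Qed.
End MaximalTilt.

(** * From finite configurations to samples *)

Lemma measure_bigcup_fin (d : measure_display) (T : measurableType d)
    (R : realType) (mu : measure T R) (I : finType) (D : pred I)
    (F : I -> set T) :
  (forall i, measurable (F i)) -> trivIset setT F ->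
  mu (\bigcup_(i in [set i | D i]) F i) = (\sum_(i | D i) mu (F i))%E.
Proof.
move=> mF tF.
rewrite measure_fin_bigcup//; [|exact: finite_finset|exact: sub_trivIset tF].
rewrite -[RHS]big_enum/= [RHS]fsbig_seq ?enum_uniq//.
suff -> : [set i | D i] = [set` enum D] by [].
by apply/seteqP; split => i /=; rewrite mem_enum.
Qed.

Section Sample.
Variables (R : realType) (d : measure_display) (T : measurableType d).
Variables (P : probability T R) (n : nat) (Y : 'I_n -> {RV P >-> R}).

Definition pattern (C : finType) (cell : R -> C) (t : T) : {ffun 'I_n -> C} :=
  [ffun j => cell (Y j t)].

Lemma pattern_eqE (C : finType) (cell : R -> C) (f : {ffun 'I_n -> C}) :
  [set t | pattern cell t = f]
  = [set t | forall j, (cell @^-1` [set f j]) (Y j t)].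
Proof.
apply/seteqP; split => t /=; first by move=> <- j; rewrite ffunE.
by move=> tf; apply/ffunP => j; rewrite ffunE.
Qed.

Lemma measurable_pattern_eq (C : finType) (cell : R -> C)
    (mcell : forall c, measurable (cell @^-1` [set c])) f :
  measurable [set t | pattern cell t = f].
Proof.
rewrite pattern_eqE.
rewrite (_ : [set _ | _] =
  \bigcap_(j in [set: 'I_n]) (Y j @^-1` (cell @^-1` [set f j]))).
  apply: fin_bigcap_measurable => // j _; exact: measurable_funPTI.
by apply/seteqP; split => t /= h j; [move=> _; exact: h|exact: h].
Qed.

Lemma pattern_bigcup (C : finType) (cell : R -> C) (D : pred {ffun 'I_n -> C}) :
  [set t | D (pattern cell t)]
  = \bigcup_(f in [set f | D f]) [set t | pattern cell t = f].
Proof.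
apply/seteqP; split => t /=; first by move=> Dt; exists (pattern cell t).
by move=> [f /= Df ->].
Qed.

Lemma measurable_pattern (C : finType) (cell : R -> C)
    (mcell : forall c, measurable (cell @^-1` [set c])) (D : pred {ffun 'I_n -> C}) :
  measurable [set t | D (pattern cell t)].
Proof.
rewrite pattern_bigcup; apply: fin_bigcup_measurable => [|f _].
  exact: finite_finset.
exact: measurable_pattern_eq.
Qed.

Lemma pattern_prob (C : finType) (cell : R -> C)
    (mcell : forall c, measurable (cell @^-1` [set c])) (q : C -> R)
    (indep : independent Y)
    (law : forall j c, P (Y j @^-1` (cell @^-1` [set c])) = (q c)%:E)
    (D : pred {ffun 'I_n -> C}) :
  P [set t | D (pattern cell t)] = (\sum_(f | D f) \prod_j q (f j))%:E.
Proof.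
rewrite pattern_bigcup measure_bigcup_fin; last 2 first.
- by move=> f; exact: measurable_pattern_eq.
- by apply/trivIsetP => f g _ _ fg; apply/seteqP; split => t //= [-> gf];
    move: fg; rewrite gf eqxx.
rewrite -sumEFin; apply: eq_bigr => f _; rewrite pattern_eqE.
apply: etrans (indep (fun j => cell @^-1` [set f j]) (fun j => mcell _)) _.
by rewrite -prodEFin; apply: eq_bigr => j _; exact: law.
Qed.

Definition crosses (C : finType) (key : C -> nat) (q : C -> R) (e : R)
    (M : nat) (f : {ffun 'I_n -> C}) : bool :=
  [exists m : 'I_M.+1, n%:R * (mass key q m + e) <= (below key m f)%:R].

(** The one-sided deviation bound. A hit at a level of mass 0 has weight 0; at a
    positive mass m, a hit forces m + e <= 1, and exponential_tilt bounds the
    likelihood ratio from below. *)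
Lemma crossing_prob (C : finType) (cell : R -> C) (key : C -> nat) (M : nat)
    (mcell : forall c, measurable (cell @^-1` [set c])) (q : C -> R)
    (indep : independent Y)
    (law : forall j c, P (Y j @^-1` (cell @^-1` [set c])) = (q c)%:E)
    (q0 : forall c, 0 <= q c) (q1 : \sum_c q c = 1) (e : R) : 0 < e -> (0 < n)%N ->
  (P [set t | crosses key q e M (pattern cell t)]
   <= (expR (- (2 * n%:R * e ^+ 2)))%:E)%E.
Proof.
move=> e0 n0.
have nR0 : 0 < n%:R :> R by rewrite ltr0n.
pose hit (m k : nat) := n%:R * (mass key q m + e) <= k%:R.
have mass0 m : 0 <= mass key q m by exact: sumr_ge0.
have [z z0 tilt] := exponential_tilt e0.
rewrite (pattern_prob mcell indep law (crosses key q e M)) lee_fin.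
have : expR (2 * n%:R * e ^+ 2) * (1 + z) ^+ n *
    \sum_(f : {ffun 'I_n -> C} | [exists m : 'I_M.+1, hit m (below key m f)])
       \prod_j q (f j) <= (1 + z) ^+ n.
  rewrite -[X in _ <= (X + _) ^+ _]q1; apply: maximal_tilt => //; first exact: ltW.
    move=> m; rewrite /hit -ltNge mulr_gt0// ltr_wpDl//.
  move=> m k kn hmk.
  have [m0|m_neq0] := eqVneq (mass key q m) 0.
    have k0 : (0 < k)%N.
      rewrite lt0n; apply/eqP => k0; move: hmk.
      by rewrite /hit k0 m0 add0r leNgt mulr_gt0.
    by rewrite m0 expr0n eqn0Ngt k0/= mulr0 add0r exprn_ge0// ltW.
  have m_gt0 : 0 < mass key q m by rewrite lt_neqAle eq_sym m_neq0 mass0.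
  have mn : mass key q m + e <= 1.
    rewrite -(ler_pM2l nR0) mulr1; apply: le_trans hmk _.
    by rewrite ler_nat.
  have ln0 : 0 <= ln (1 + z / mass key q m).
    by rewrite ln_ge0// lerDl divr_ge0// ltW.
  have z1 : 0 < 1 + z by rewrite addr_gt0.
  have zm : 0 < 1 + z / mass key q m by rewrite addr_gt0// divr_gt0.
  have -> : mass key q m + z = mass key q m * (1 + z / mass key q m).
    by rewrite mulrDr mulr1 mulrCA divff ?mulr1.
  rewrite exprMn mulrC ler_wpM2l ?exprn_ge0//.
  rewrite -[X in X ^+ n](@lnK R (1 + z)) ?posrE//.
  rewrite -[X in X ^+ k](@lnK R (1 + _)) ?posrE//.
  rewrite -!expRM_natl -expRD ler_expR.
  apply: le_trans (ler_wpM2r ln0 hmk).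
  rewrite -mulrA [2 * _]mulrCA -!mulrA -mulrDr ler_pM2l//.
  by apply: le_trans (tilt _ m_gt0 mn); rewrite mulrA.
rewrite mulrAC ger_pMl ?exprn_gt0 ?addr_gt0//.
by rewrite expRN -ler_pdivlMl ?expR_gt0// mulr1.
Qed.
End Sample.

(** * The Dvoretzky-Kiefer-Wolfowitz inequality *)

Section Grid.
Variables (R : realType) (K : nat) (x : 'I_K -> R).

(** Counting the points below y classifies y without sorting the grid. *)
Definition grid_cell (y : R) : 'I_K.+1 := inord #|[set i | x i < y]%SET|.

Lemma val_grid_cell (y : R) : grid_cell y = #|[set i | x i < y]%SET| :> nat.
Proof. by rewrite inordK// ltnS -[leqRHS]card_ord max_card. Qed.

Lemma grid_cell_mono : {homo grid_cell : y z / y <= z >-> (y <= z)%N}.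
Proof.
move=> y z yz; rewrite !val_grid_cell; apply/subset_leq_card/fintype.subsetP => i.
by rewrite !inE => /lt_le_trans; apply.
Qed.

Lemma le_gridE (y : R) (i : 'I_K) : (y <= x i) = (grid_cell y <= grid_cell (x i))%N.
Proof.
apply/idP/idP => [|]; first exact: grid_cell_mono.
apply: contraTT; rewrite -ltNge -ltnNge => xy; rewrite !val_grid_cell.
apply/proper_card/fintype.properP; split.
  by apply/fintype.subsetP => k; rewrite !inE => /lt_trans; apply.
by exists i; rewrite !inE ?ltxx.
Qed.

Lemma measurable_grid_cell (c : 'I_K.+1) : measurable (grid_cell @^-1` [set c]).
Proof.
apply: measurable_realfun.is_interval_measurable => y z /= yc zc u /andP[yu uz].
apply: val_inj; apply/eqP; rewrite eqn_leq.
by apply/andP; split; [rewrite -zc|rewrite -yc]; exact: grid_cell_mono.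
Qed.

End Grid.

Lemma sum_cell_prob (d : measure_display) (T : measurableType d) (R : realType)
    (P : probability T R) (X : {RV P >-> R}) (C : finType) (cell : R -> C)
    (mcell : forall c, measurable (cell @^-1` [set c])) (D : pred C) :
  \sum_(c | D c) fine (P (X @^-1` (cell @^-1` [set c])))
  = fine (P (X @^-1` [set y | D (cell y)])).
Proof.
have mX c : measurable (X @^-1` (cell @^-1` [set c])) by exact: measurable_funPTI.
rewrite sum_fine => [|c _]; last exact: fin_num_measure.
rewrite -measure_bigcup_fin//; last first.
  by apply/trivIsetP => a b _ _ ab; apply/seteqP; split => t //= [-> ba];
    move: ab; rewrite ba eqxx.
congr (fine (P _)); apply/seteqP; split => t /=.
  by move=> [c /= Dc ->].
by move=> Dc; exists (cell (X t)).
Qed.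

Section DKW.
Variables (R : realType) (d0 : measure_display) (T0 : measurableType d0).
Variables (P0 : probability T0 R) (X : {RV P0 >-> R}).
Variables (d : measure_display) (T : measurableType d) (P : probability T R).
Variables (n : nat) (Y : 'I_n -> {RV P >-> R}).
Hypotheses (n0 : (0 < n)%N) (indep : independent Y).
Hypothesis law : forall j, same_distribution (Y j) X.
Variables (e : R) (e0 : 0 < e).

Let F (x : R) : R := fine (cdf X x).
Let Fn (t : T) : R -> R := empirical_cdf (fun j => Y j t).

Lemma measurable_deviation (K : nat) (x : 'I_K -> R) :
  measurable [set t | [exists i, e < `|Fn t (x i) - F (x i)|]%R].
Proof.
pose D (f : {ffun 'I_n -> 'I_K.+1}) :=
  [exists i, e <
    `|n%:R^-1 * #|[set j | (f j <= grid_cell x (x i))%N]%SET|%:R - F (x i)|].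
have DE t : D (pattern Y (grid_cell x) t)
    = [exists i, e < `|Fn t (x i) - F (x i)|].
  apply: eq_existsb => i; rewrite /Fn /empirical_cdf.
  rewrite (_ : #|_| = #|[set j | Y j t <= x i]%SET|)//.
  by apply: eq_card => j; rewrite !inE ffunE le_gridE.
under eq_set do rewrite -DE.
exact: (measurable_pattern Y (measurable_grid_cell x)).
Qed.

(** A union bound over the two signs. A deviation F - Fn > e is a deviation of the
    masses of the upper half-lines in the other direction, hence a hit for the
    reversed numbering rkey of the cells. *)
Lemma grid_deviation (K : nat) (x : 'I_K -> R) :
  (P [set t | [exists i, e < `|Fn t (x i) - F (x i)|]%R]
   <= (2 * expR (- (2 * n%:R * e ^+ 2)))%:E)%E.
Proof.
have nR0 : 0 < n%:R :> R by rewrite ltr0n.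
have mcell := measurable_grid_cell x.
pose q c := fine (P0 (X @^-1` (grid_cell x @^-1` [set c]))).
have lawq j c : P (Y j @^-1` (grid_cell x @^-1` [set c])) = (q c)%:E.
  rewrite fineK; last by apply: fin_num_measure; exact: measurable_funPTI.
  exact: (law j (mcell c)).
have q0 c : 0 <= q c by rewrite fine_ge0.
have q1 : \sum_c q c = 1.
  rewrite sum_cell_prob// (_ : _ @^-1` _ = [set: T0]) ?probability_setT//.
  by apply/seteqP.
have le_F i : \sum_(c : 'I_K.+1 | (c <= grid_cell x (x i))%N) q c = F (x i).
  rewrite sum_cell_prob// /F /cdf/= /distribution /pushforward.
  congr (fine (P0 _)); apply/seteqP; split => t /=; rewrite in_itv/= le_gridE//.
have gt_F i : \sum_(c : 'I_K.+1 | (grid_cell x (x i) < c)%N) q c = 1 - F (x i).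
  rewrite -le_F; apply/esym/eqP; rewrite subr_eq -q1 addrC; apply/eqP.
  rewrite [LHS](bigID (fun c : 'I_K.+1 => (c <= grid_cell x (x i))%N))/=.
  by congr (_ + _); apply: eq_bigl => c; rewrite ltnNge.
have FnE t i : n%:R * Fn t (x i) = #|[set j | Y j t <= x i]%SET|%:R.
  by rewrite /Fn /empirical_cdf mulrA divff ?mul1r ?gt_eqF.
have massE m : mass (@nat_of_ord _) q m.+1 = \sum_(c : 'I_K.+1 | (c <= m)%N) q c by [].
pose rkey (c : 'I_K.+1) := (K - c)%N.
pose up := [set t | crosses (@nat_of_ord _) q e K.+1 (pattern Y (grid_cell x) t)].
pose dn := [set t | crosses rkey q e K.+1 (pattern Y (grid_cell x) t)].
have mup : measurable up.
  exact: (measurable_pattern Y mcell (crosses (@nat_of_ord _) q e K.+1)).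
have mdn : measurable dn.
  exact: (measurable_pattern Y mcell (crosses rkey q e K.+1)).
apply: (@le_trans _ _ (P (up `|` dn))).
  apply: le_measure; rewrite ?inE.
  - exact: (measurable_deviation x).
  - exact: measurableU.
  move=> t /existsP[i]; rewrite ltNge ler_norml negb_and -!ltNge.
  pose m := grid_cell x (x i).
  have mK : (m <= K)%N by rewrite -ltnS.
  move=> /orP[dev|dev]; [right|left].
    apply/existsP; exists (inord (K - m)).
    rewrite inordK; last by rewrite ltnS leqW// leq_subr.
    have -> : mass rkey q (K - m) = 1 - F (x i).
      rewrite -gt_F; apply: eq_bigl => c.
      by rewrite /rkey ltn_sub2lE// -ltnS.
    have -> : below rkey (K - m) (pattern Y (grid_cell x) t)
            = (n - #|[set j | (Y j t <= x i)%R]%SET|)%N.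
      apply/eqP; rewrite -(eqn_add2l #|[set j | (Y j t <= x i)%R]%SET|).
      rewrite subnKC; last by rewrite -[leqRHS]card_ord max_card.
      rewrite -[X in _ == X]card_ord -(cardsC [set j | (Y j t <= x i)%R]%SET).
      rewrite eqn_add2l; apply/eqP/eq_card => j.
      rewrite !inE ffunE le_gridE -ltnNge.
      by rewrite /rkey ltn_sub2lE// -ltnS.
    rewrite natrB; last by rewrite -[leqRHS]card_ord max_card.
    rewrite -FnE -[X in _ <= X - _]mulr1 -mulrBr ler_pM2l//.
    by lra.
  apply/existsP; exists (inord m.+1).
  rewrite inordK; last by rewrite !ltnS.
  rewrite massE le_F.
  have -> : below (@nat_of_ord _) m.+1 (pattern Y (grid_cell x) t)
          = #|[set j | (Y j t <= x i)%R]%SET|.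
    by apply: eq_card => j; rewrite !inE ffunE ltnS le_gridE.
  by rewrite -FnE ler_pM2l//; lra.
rewrite mulr_natl mulr2n EFinD; apply: le_trans (measureU2 _ _ _) _ => //.
by apply: leeD; exact: crossing_prob.
Qed.

Let rat_seq (i : nat) : R := ratr (odflt 0 (unpickle i)).

Let deviation (K : nat) : set T :=
  [set t | [exists i : 'I_K, e < `|Fn t (rat_seq i) - F (rat_seq i)|]].

(** The Dvoretzky-Kiefer-Wolfowitz inequality with Massart's constant. The
    exceptional event is the union over all rationals of the deviations there; it
    catches the deviation at a real x as Fn and F are right-continuous. *)
Theorem dkw_massart : exists U : set T,
  [/\ measurable U, (P U <= (2 * expR (- (2 * n%:R * e ^+ 2)))%:E)%E &
      forall t, ~ U t -> forall x : R, `|Fn t x - F x| <= e].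
Proof.
have mdev K : measurable (deviation K).
  exact: (measurable_deviation (fun i : 'I_K => rat_seq i)).
have mU : measurable (\bigcup_K deviation K) by exact: bigcup_measurable.
exists (\bigcup_K deviation K); split => //.
  have := nondecreasing_cvg_mu (mu := P) mdev mU.
  have nd : {homo deviation : K L / (K <= L)%N >-> (K <= L)%O}.
    move=> K L KL; apply/subsetPset => t /existsP[i ti].
    by apply/existsP; exists (widen_ord KL i).
  move=> /(_ nd) cvgP.
  rewrite -(cvg_lim _ cvgP)//; apply: lime_le.
    by apply/cvg_ex; eexists; exact: cvgP.
  apply: nearW => K; exact: (grid_deviation (fun i : 'I_K => rat_seq i)).
move=> t tU x; rewrite leNgt; apply/negP => dev_x.
have dev_rat (r : rat) : ~ e < `|Fn t (ratr r) - F (ratr r)|.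
  move=> dev; apply: tU; exists (pickle r).+1 => //=.
  apply/existsP; exists ord_max => /=; by rewrite /rat_seq pickleK.
have Fn_right : \forall z \near x^'+, Fn t z = Fn t x.
  have : \forall z \near x^'+, forall j : 'I_n, (Y j t <= z) = (Y j t <= x).
    apply: filter_forall => j.
    have [Yx|xY] := leP (Y j t) x.
      near=> z; apply/idP; apply: le_trans Yx _.
      by near: z; exact: nbhs_right_ge.
    near=> z; apply/negbTE; rewrite -ltNge.
    by near: z; exact: nbhs_right_lt.
  apply: filterS => z zx; rewrite /Fn /empirical_cdf.
  by congr (_ * _%:R); apply: eq_card => j; rewrite !inE zx.
have F_right : F z @[z --> x^'+] --> F x.
  apply: fine_cvg; rewrite fineK; last first.
    by apply: fin_num_measure; exact: measurable_itv.
  exact: cdf_right_continuous.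
have dev_right : \forall z \near x^'+, e < `|Fn t z - F z|.
  have F_dev : Fn t x - F z @[z --> x^'+] --> Fn t x - F x.
    by apply: cvgB F_right; exact: cvg_cst.
  near=> z; rewrite (_ : Fn t z = Fn t x); last by near: z.
  by near: z; exact: (cvgr_norm_gt _ F_dev).
have /nbhs_ballP[r /= r0 dev_ball] : \forall z \near x, x < z ->
    e < `|Fn t z - F z| by exact: dev_right.
have [q] := rat_in_itvoo (ltr_pwDr r0 (lexx x)).
rewrite in_itv/= => /andP[xq qr]; apply: (dev_rat q); apply: dev_ball => //.
by rewrite /ball/= ltr_distlC; apply/andP; split; lra.
Unshelve. all: by end_near.
Qed.
End DKW.

Theorem theorem3 (R : realType) (n p N Ns : nat) (hNs : (0 < Ns)%N)
    (d0 : measure_display) (T0 : measurableType d0) (P0 : probability T0 R)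
    (w : {RV P0 >-> borel_cV R (p * N)})
    (d : measure_display) (T : measurableType d) (P : probability T R)
    (ws : 'I_Ns -> {RV P >-> borel_cV R (p * N)})
    (ws_indep : independent ws)
    (ws_distr : forall j : 'I_Ns, same_distribution (ws j) w)
    (G : 'M[R]_(n * N.+1, p * N)) (p_i : 'cV[R]_(n * N.+1))
    (Sigma : 'M[R]_(p * N)) (Sigma_psd : psd Sigma)
    (xlb epsD epsE alpha : R)
    (epsD_ge0 : 0 <= epsD) (epsE_gt0 : 0 < epsE)
    (alphaE : alpha = 2 * expR (- (2 * Ns%:R * epsE ^+ 2))) :
  let a : 'rV[R]_(p * N) := p_i^T *m G in
  let v : R := (a *m Sigma *m a^T) 0 0 in
  let y (t : T) (j : 'I_Ns) : R := lin_form a (ws j t) in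
  let Phi (x : R) : R := fine (cdf (lin_form a \o w : {RV P0 >-> R}) x) in
  {ae P, forall t : T, forall x : R, x \in `[xlb, +oo[ ->
     `|empirical_cdf (y t) x - smoothed_cdf (y t) v x| <= epsD} ->
  with_probability_ge P (1 - alpha)
    [set t : T | forall x : R, x \in `[xlb, +oo[ ->
       `|smoothed_cdf (y t) v x - Phi x| <= epsE + epsD].
Proof.
move=> a v y Phi smoothing.
pose X : {RV P0 >-> R} := lin_form a \o w.
pose Y (j : 'I_Ns) : {RV P >-> R} := lin_form a \o ws j.
have mpre (B : set R) : measurable B -> measurable (lin_form a @^-1` B).
  by move=> mB; exact: (measurable_funPTI (lin_form a : {mfun _ >-> _})).
have Y_indep : independent Y.
  move=> B mB; have := ws_indep (fun j => lin_form a @^-1` B j).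
  by apply => j; exact: mpre.
have Y_law j : same_distribution (Y j) X.
  by move=> B mB; exact: (ws_distr j _ (mpre _ mB)).
have [U [mU PU devU]] := dkw_massart hNs Y_indep Y_law epsE_gt0.
have [A [mA PA0 subA]] := smoothing.
exists (~` (U `|` A)); split.
- exact/measurableC/measurableU.
- rewrite probability_setC; last exact: measurableU.
  rewrite EFinB leeB// alphaE.
  apply: (@le_trans _ _ (P U + P A)%E); first exact: measureU2.
  by rewrite (_ : P A = 0%E) ?adde0.
move=> t /not_orP[tU tA] x xD.
have t_smooth : `|empirical_cdf (y t) x - smoothed_cdf (y t) v x| <= epsD.
  by apply: contrapT => nt; apply: tA; apply: subA => /= smooth_t; exact/nt/smooth_t.
have t_emp : `|empirical_cdf (y t) x - Phi x| <= epsE := devU t tU x.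
rewrite -(subrKA (empirical_cdf (y t) x)) (le_trans (ler_normD _ _))//.
by rewrite addrC lerD// distrC.
Qed.
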